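(* Let $m\in(0,1)$ be fixed. For every convex hexagon $K$ in the plane, with first $m$-Kasner descendant $K'$, $$1-2m(1-m)<\frac{\Delta(K')}{\Delta(K)}<1.$$ Moreover, both the lower and the upper bound are best possible: for every $\epsilon>0$ there exists a convex hexagon $K$ with $\frac{\Delta(K')}{\Delta(K)}<1-2m(1-m)+\epsilon$, and there exists a convex hexagon $K$ with $\frac{\Delta(K')}{\Delta(K)}>1-\epsilon$.
   Context: $\Delta(\cdot)$ denotes the area of a polygon. Convex polygons are nondegenerate (any three consecutive vertices form a triangle of positive area). For $m\in(0,1)$ and a convex $n$-gon $K=A_1A_2\ldots A_n$ with vertices listed in counterclockwise cyclic order (indices modulo $n$), the first $m$-Kasner descendant of $K$ is the convex $n$-gon $K'=B_1B_2\ldots B_n$, where $B_i$ is the point on the side $A_iA_{i+1}$ with $A_iB_i:B_iA_{i+1}=m:(1-m)$, i.e. $\overrightarrow{A_iB_i}=m\,\overrightarrow{A_iA_{i+1}}$. Here $n=6$. *)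

(* Defs.v *)
From HB Require Import structures.
From mathcomp Require Import all_boot all_order all_algebra.
From mathcomp Require Import all_classical all_reals all_analysis.
Import Order.TTheory GRing.Theory Num.Theory.
Import numFieldNormedType.Exports.

Set Implicit Arguments.
Unset Strict Implicit.
Unset Printing Implicit Defensive.

Local Open Scope classical_set_scope.
Local Open Scope ring_scope.

(* Twice the signed area of the triangle PQS: it is positive exactly when
   S lies strictly to the left of the line directed from P to Q. *)
Definition cross (R : realType) (P Q S : R * R) : R :=
  (Q.1 - P.1) * (S.2 - P.2) - (Q.2 - P.2) * (S.1 - P.1).

(* Vertices are indexed cyclically ([ordS] is the successor modulo n) and listed
   counterclockwise: all the other vertices lie strictly to the left of each
   directed side.  With j = i + 2 this is the nondegeneracy requirement that
   consecutive vertices form a triangle of positive area.  Requiring it for every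
   j, not only j = i + 2, excludes star-shaped and multiply wound closed paths. *)
Definition convex_polygon (R : realType) (n : nat) (A : 'I_n -> R * R) : Prop :=
  (2 < n)%N /\
  forall i j : 'I_n, j != i -> j != ordS i -> 0 < cross (A i) (A (ordS i)) (A j).

(* The closed plane region bounded by a convex polygon is the convex hull of its
   vertices. *)
Definition polygon_region (R : realType) (n : nat) (A : 'I_n -> R * R) :
    set (R * R) :=
  [set P | exists w : 'I_n -> R,
    [/\ forall i, 0 <= w i, \sum_(i < n) w i = 1 & P = \sum_(i < n) w i *: A i]].

(* Two-dimensional Lebesgue measure of the region, which is compact, so that
   [fine] only converts a finite extended real to a real. *)
Definition area (R : realType) (n : nat) (A : 'I_n -> R * R) : R :=
  fine ((lebesgue_measure \x lebesgue_measure)%E (polygon_region A)).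

Definition kasner (R : realType) (n : nat) (m : R) (A : 'I_n -> R * R) :
    'I_n -> R * R :=
  fun i => A i + m *: (A (ordS i) - A i).

(* Main.v *)
(* Let S be twice the area of K = A_0...A_5.  The descendant K' is K minus its six
   corner triangles B_i A_(i+1) B_(i+1), whose doubled areas are m (1 - m) t_i with
   t_i = [A_i A_(i+1) A_(i+2)], so the area ratio is 1 - m (1 - m) (t_0 + ... + t_5) / S.
   The t_i are positive, which gives the upper bound.  Since t_0 + t_2 + t_4 =
   S - [A_0 A_2 A_4] and t_1 + t_3 + t_5 = S - [A_1 A_3 A_5], their sum is less than
   2 S, which gives the lower bound.  The sum tends to 0 when the vertices merge in
   pairs to the vertices of a triangle, and to 2 S when four consecutive vertices
   merge to one vertex of a triangle.

   The Lebesgue measure of a hexagon is obtained by a fan triangulation; that of a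
   triangle by integrating the lengths of its vertical sections. *)

Require Import Defs.
From mathcomp Require Import all_boot all_order all_algebra.
From mathcomp Require Import all_classical all_reals all_analysis.
From mathcomp Require Import measurable_realfun zify ring lra.
Import Order.TTheory GRing.Theory Num.Theory.
Import numFieldNormedType.Exports.

Local Open Scope ring_scope.

(** * Algebraic identities for the signed area *)

Section Cross.
Context {R : realType}.
Implicit Types P Q S X : R * R.

Lemma cross_rot P Q S : cross P Q S = cross Q S P.
Proof. rewrite /cross; ring. Qed.

Lemma cross_swap P Q S : cross Q P S = - cross P Q S.
Proof. rewrite /cross; ring. Qed.

(** [cross U V] is affine and X has barycentric coordinates proportional to the three crosses
    against the sides of PQS; clearing the denominator [cross P Q S] leaves a polynomial
    identity. *)
Lemma cross_barycentric P Q S U V X :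
  cross P Q S * cross U V X =
    cross Q S X * cross U V P + cross S P X * cross U V Q +
    cross P Q X * cross U V S.
Proof. rewrite /cross; ring. Qed.

(** The three-term Plücker relation for the vectors from P to A, B, C and D. *)
Lemma cross_plucker P A B C D :
  cross P A C * cross P B D =
    cross P A B * cross P C D + cross P A D * cross P B C.
Proof. rewrite /cross; ring. Qed.

Lemma cross_sum n P Q (w : 'I_n -> R) (A : 'I_n -> R * R) :
  \sum_(i < n) w i = 1 ->
  cross P Q (\sum_(i < n) w i *: A i) = \sum_(i < n) w i * cross P Q (A i).
Proof.
move=> w1; rewrite /cross !raddf_sum /=.
(* The part constant in the third point is spread over the sum with weights [w i], which total 1. *)
rewrite [RHS](eq_bigr (fun i => (Q.1 - P.1) * (w i * (A i).2) -
  (Q.2 - P.2) * (w i * (A i).1) -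
  w i * ((Q.1 - P.1) * P.2 - (Q.2 - P.2) * P.1))); last by move=> i _; ring.
by rewrite !sumrB -!mulr_sumr -mulr_suml w1; ring.
Qed.

End Cross.

(** * Half-planes, triangles and convex hulls *)

Section Region.
Local Open Scope classical_set_scope.
Context {R : realType}.
Implicit Types P Q S X : R * R.

Definition halfplane P Q : set (R * R) := [set X | 0 <= cross P Q X].

(** As an intersection of half-planes, not a hull, it is visibly measurable and has explicit
    vertical sections. It is the intended triangle when P, Q, S are counterclockwise. *)
Definition triangle P Q S : set (R * R) :=
  halfplane P Q `&` halfplane Q S `&` halfplane S P.

Lemma triangle_rot P Q S : triangle P Q S = triangle Q S P.
Proof. by rewrite /triangle -[LHS]setIA setIC. Qed.

Lemma triangle_sub_halfplane P Q S U V : 0 < cross P Q S ->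
  0 <= cross U V P -> 0 <= cross U V Q -> 0 <= cross U V S ->
  triangle P Q S `<=` halfplane U V.
Proof.
move=> PQS UVP UVQ UVS X [[/= PQX QSX] SPX]; rewrite /halfplane /=.
by rewrite -(pmulr_rge0 _ PQS) cross_barycentric !addr_ge0// mulr_ge0.
Qed.

Lemma polygon_region_sub_halfplane n (A : 'I_n -> R * R) U V :
  (forall i, 0 <= cross U V (A i)) -> polygon_region A `<=` halfplane U V.
Proof.
move=> UVA _ [w [w0 w1 ->]]; rewrite /halfplane /= cross_sum// sumr_ge0// => i _.
exact: mulr_ge0.
Qed.

Lemma triangle_sub_polygon_region n (A : 'I_n -> R * R) i j k :
  0 < cross (A i) (A j) (A k) ->
  triangle (A i) (A j) (A k) `<=` polygon_region A.
Proof.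
set c := cross _ _ _ => c0 X [[/= ijX jkX] kiX].
(* A general module [V] serves both the sum of the weights ([R^o]) and the sum of the points. *)
have sum_delta (V : lmodType R) (a : R) l (F : 'I_n -> V) :
    \sum_(x < n) (a * (x == l)%:R) *: F x = a *: F l.
  rewrite (bigD1 l)//= eqxx mulr1 big1 ?addr0// => x /negbTE ->.
  by rewrite mulr0 scale0r.
(* The barycentric coordinates of X, to be used as hull weights at the indices i, j, k. *)
pose u := cross (A j) (A k) X / c; pose v := cross (A k) (A i) X / c.
pose t := cross (A i) (A j) X / c.
exists (fun x => u * (x == i)%:R + v * (x == j)%:R + t * (x == k)%:R); split.
- have div0 a : 0 <= a -> 0 <= a / c by move=> a0; rewrite divr_ge0// ltW.
  by move=> x; rewrite !addr_ge0// mulr_ge0// div0.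
- rewrite !big_split/=.
  have sum1 (a : R) l : \sum_(x < n) a * (x == l)%:R = a.
    rewrite -[RHS]mulr1 -[RHS](sum_delta R^o a l (fun=> 1)).
    by apply: eq_bigr => x _; rewrite -[RHS]/(_ * 1) mulr1.
  rewrite !sum1 /u /v /t -!mulrDl; apply: (canLR (mulfK _)); first exact: lt0r_neq0.
  by rewrite mul1r /c /cross; ring.
- rewrite (eq_bigr (fun x => (u * (x == i)%:R) *: A x + (v * (x == j)%:R) *: A x +
    (t * (x == k)%:R) *: A x)); last by move=> x _; rewrite !scalerDl.
  rewrite !big_split/= !sum_delta.
  have cn0 : c != 0 by exact: lt0r_neq0.
  apply/(@scalerI _ _ _ cn0); rewrite !scalerDr !scalerA.
  rewrite !(mulrC c) !divfK//.
  case: X {u v t ijX jkX kiX} => X1 X2; rewrite /c /cross.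
  congr pair; rewrite /= /GRing.scale/=; ring.
Qed.

End Region.

(** * Null lines, trapezoids and cutting along a line *)

Section AreaMeasure.
Local Open Scope classical_set_scope.
Context {R : realType}.
Implicit Types P Q S X : R * R.

Local Notation mu := (@lebesgue_measure R).
Local Notation mu2 := (mu \x mu)%E.

Lemma measurable_halfplane P Q : measurable (halfplane P Q).
Proof.
have mc : measurable_fun setT (cross P Q).
  apply: measurable_funB; apply: measurable_funM => //;
    apply: measurable_funB => //.
have := mc measurableT `[0, +oo[%classic (measurable_itv _).
rewrite setTI; congr measurable.
by apply/seteqP; split=> X; rewrite /halfplane /= in_itv/= andbT.
Qed.

(** The vertical sections of a non-vertical line are single points; those of a vertical line are
    empty except over one abscissa, a null set. *)
Lemma line_null P Q : P != Q ->
  mu2 (halfplane P Q `&` halfplane Q P) = 0%E.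
Proof.
move=> PQ; set D := _ `&` _.
have DE x y : D (x, y) <-> (Q.1 - P.1) * (y - P.2) = (Q.2 - P.2) * (x - P.1).
  rewrite /D /halfplane /= (cross_swap P Q) /cross /= oppr_ge0; split.
    by move=> [h1 h2]; apply/eqP; rewrite -subr_eq0 eq_le h1 h2.
  by move=> ->; rewrite subrr.
have mD : measurable D by apply: measurableI; exact: measurable_halfplane.
rewrite /product_measure1.
transitivity (\int[mu]_(x in setT) cst 0 x)%E; last by rewrite integral0.
apply: ae_eq_integral => //; first exact: measurable_fun_xsection.
have [PQ1|PQ1] := eqVneq Q.1 P.1; last first.
  apply/aeW => x _ /=; apply: (@subset_measure0 _ _ _ mu _
    [set P.2 + (Q.2 - P.2) * (x - P.1) / (Q.1 - P.1)]) => //.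
  - exact: measurable_xsection.
  - move=> y; rewrite /xsection /= inE => /DE e.
    by rewrite -e mulrC mulKf ?subr_eq0// addrC subrK.
  - exact: lebesgue_measure_set1.
exists [set P.1]; split => //; first exact: lebesgue_measure_set1.
move=> x /= H; apply: contrapT => xP; apply: H => _.
rewrite (_ : xsection D x = set0) ?measure0//.
rewrite -subset0 => y; rewrite /xsection /= inE => /DE /esym/eqP.
rewrite PQ1 subrr mul0r mulf_eq0 !subr_eq0 => /orP[/eqP PQ2|/eqP//].
by move/eqP: PQ; apply; rewrite (surjective_pairing P) (surjective_pairing Q) PQ1 PQ2.
Qed.

(** A trapezoid with vertical parallel sides: its lower edge joins (a, pa) to (b, pb), its upper
    edge (a, qa) to (b, qb), and both inequalities are multiplied by b - a. The sections over a and
    b are left free, as they do not affect the integral. The case a = b arises when two vertices of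
    a triangle share an abscissa. *)
Lemma measure_between (D : set (R * R)) (a b pa pb qa qb : R) :
  measurable D -> a <= b -> pa <= qa -> pb <= qb ->
  (forall x y, D (x, y) -> a <= x <= b) ->
  (forall x y, a < x < b ->
     D (x, y) <-> (pa * (b - x) + pb * (x - a) <= (b - a) * y
                   <= qa * (b - x) + qb * (x - a))) ->
  mu2 D = ((qa - pa + (qb - pb)) * (b - a) / 2)%:E.
Proof.
move=> mD; rewrite le_eqVlt => /predU1P[<- _ _ Dab _|ab pqa pqb Dab DE].
  rewrite subrr mulr0 mul0r.
  have lineN : (a, 0) != (a, 1) :> R * R by rewrite xpair_eqE eqxx eq_sym oner_eq0.
  apply: (@subset_measure0 _ _ _ mu2 _ _ mD _ _ (line_null _ _ lineN)).
    exact: measurableI (measurable_halfplane _ _) (measurable_halfplane _ _).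
  case=> x y /Dab; rewrite -eq_le => /eqP ->.
  by rewrite /halfplane /cross /=; split=> /=; lra.
have ba0 : 0 < b - a by rewrite subr_gt0.
rewrite /product_measure1.
pose h x := ((qa - pa) * (b - x) + (qb - pb) * (x - a)) / (b - a).
have mF : measurable_fun setT (mu \o xsection D) by exact: measurable_fun_xsection.
transitivity (\int[mu]_(x in `[a, b]) (mu \o xsection D) x)%E.
  rewrite [RHS]integral_mkcond; apply: eq_integral => x _.
  rewrite patchE; case: ifPn => // xab /=.
  rewrite (_ : xsection D x = set0) ?measure0//.
  rewrite -subset0 => y; rewrite /xsection /= inE => /Dab xab'.
  by move: xab; rewrite notin_setE /= in_itv/= xab'.
rewrite integral_itv_bndoo; last exact: measurable_funTS.
have mh : measurable_fun setT h.
  by apply: measurable_funM => //; apply: measurable_funD;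
    apply: measurable_funM => //; apply: measurable_funB.
transitivity (\int[mu]_(x in `]a, b[) (h x)%:E)%E.
  apply: eq_integral => x; rewrite inE/= in_itv/= => xab.
  have xE : xsection D x = `[(pa * (b - x) + pb * (x - a)) / (b - a),
                             (qa * (b - x) + qb * (x - a)) / (b - a)].
    apply/seteqP; split => y; rewrite /xsection /= inE in_itv/=.
      by move=> /(DE _ _ xab); rewrite ler_pdivrMr// ler_pdivlMr// !(mulrC y).
    by rewrite ler_pdivrMr// ler_pdivlMr// !(mulrC y) => ?; apply/DE.
  rewrite xE lebesgue_measure_itv /= lte_fin.
  (* The length of an interval is given by cases; if the lower end is not strictly below the upper
     one, [pqa] and [pqb] force equality and h x = 0. *)
  case: ltP => [_|]; rewrite /h.
    by rewrite -EFinB; congr EFin; rewrite -mulrBl; congr (_ / _); ring.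
  rewrite ler_pdivrMr// divfK ?gt_eqF// => le_qp.
  congr EFin; apply/esym/eqP; rewrite mulf_eq0; apply/orP; left.
  by move/andP: xab => [ax xb]; apply/eqP; nra.
rewrite -(@integral_itv_bndoo R a b (EFin \o h) true false); last first.
  by apply: measurable_funTS; exact/measurable_EFinP.
(* The section length is affine in x, with slope [al] and intercept [be]; F is its primitive. *)
pose al := ((qb - pb) - (qa - pa)) / (b - a).
pose be := ((qa - pa) * b - (qb - pb) * a) / (b - a).
have hE : h = fun x => al * x + be.
  by apply/funext => x; rewrite /h /al /be; field; rewrite gt_eqF.
pose F x : R := al / 2 * x ^+ 2 + be * x.
have dF (x : R) : is_derive x (1 : R) (F : R -> R) (h x).
  rewrite hE; apply: is_derive_eq.
  by rewrite /GRing.scale/=; field.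
rewrite (@continuous_FTC2 R h F).
- rewrite -EFinB; congr EFin; rewrite /F /al /be; field; by rewrite gt_eqF.
- exact: ab.
- apply: continuous_subspaceT => x; rewrite hE.
  apply: cvgD; last exact: cvg_cst.
  by apply: cvgM; [exact: cvg_cst|exact: cvg_id].
- have cF : continuous F.
    by move=> x; apply/differentiable_continuous/derivable1_diffP; case: (dF x).
  split.
  + by move=> x _; case: (dF x).
  + exact/cvg_at_right_filter/cF.
  + exact/cvg_at_left_filter/cF.
- by move=> x _; rewrite derive1E; case: (dF x).
Qed.

(** The two closed half-planes cover the plane and overlap in a null line. *)
Lemma measure_cut (D : set (R * R)) P Q : measurable D -> P != Q ->
  mu2 D = (mu2 (D `&` halfplane P Q) + mu2 (D `&` halfplane Q P))%E.
Proof.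
move=> mD PQ.
have mh U V := measurable_halfplane U V.
have mDQ : measurable (D `&` halfplane Q P) by exact: measurableI.
rewrite (measureDI mu2 mD (mh P Q)) [RHS]addeC; congr (_ + _)%E.
rewrite (measureDI mu2 mDQ (mh P Q)).
rewrite [X in (_ = _ + X)%E](_ : _ = 0%E); last first.
  apply: (@subset_measure0 _ _ _ mu2 _ (halfplane P Q `&` halfplane Q P)).
  - exact: measurableI mDQ (mh P Q).
  - exact: measurableI (mh P Q) (mh Q P).
  - by move=> X [[]].
  - exact: line_null.
rewrite adde0; congr (_ _); apply/seteqP; split=> X [].
  move=> DX; rewrite /halfplane /= => /negP; rewrite -ltNge => X0; split=> //.
    by split=> //=; rewrite cross_swap oppr_ge0 ltW.
  by apply/negP; rewrite -ltNge.
by move=> [].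
Qed.

End AreaMeasure.

(** * The Lebesgue measure of a triangle *)

Section TriangleMeasure.
Local Open Scope classical_set_scope.
Context {R : realType}.
Implicit Types P Q S X : R * R.

Local Notation mu := (@lebesgue_measure R).
Local Notation mu2 := (mu \x mu)%E.

Lemma measurable_triangle P Q S : measurable (triangle P Q S).
Proof. by do 2?apply: measurableI; exact: measurable_halfplane. Qed.

Let left_halfplane (c x y : R) : halfplane (c, 0) (c, 1) (x, y) <-> x <= c.
Proof. by rewrite /halfplane /cross /=; split=> ?; lra. Qed.

Let right_halfplane (c x y : R) : halfplane (c, 1) (c, 0) (x, y) <-> c <= x.
Proof. by rewrite /halfplane /cross /=; split=> ?; lra. Qed.

Lemma triangle_between_abscissae P Q S a b x y : 0 < cross P Q S ->
  a <= P.1 <= b -> a <= Q.1 <= b -> a <= S.1 <= b ->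
  triangle P Q S (x, y) -> a <= x <= b.
Proof.
move=> PQS /andP[aP Pb] /andP[aQ Qb] /andP[aS Sb] T; apply/andP; split.
  apply/(right_halfplane a x y); apply: (@triangle_sub_halfplane _ P Q S) T => //;
  rewrite /cross/=; lra.
apply/(left_halfplane b x y); apply: (@triangle_sub_halfplane _ P Q S) T => //;
  rewrite /cross/=; lra.
Qed.

(** The vertical line through the vertex of middle abscissa cuts the triangle into two trapezoids,
    each with one parallel side shrunk to a vertex. They share the other parallel side, and their
    widths add up to that of the triangle. *)
Let measure_triangle_leftmost P Q S : 0 < cross P Q S ->
  P.1 <= Q.1 -> P.1 <= S.1 -> mu2 (triangle P Q S) = (cross P Q S / 2)%:E.
Proof.
move=> c0 PQ1 PS1.
have mT := measurable_triangle P Q S.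
have vert (c : R) : (c, 0) != (c, 1) :> R * R.
  by rewrite xpair_eqE eqxx eq_sym oner_eq0.
have mh U V := @measurable_halfplane R U V.
have [QS1|SQ1] := leP Q.1 S.1.
- have Tx x y := @triangle_between_abscissae P Q S P.1 S.1 x y c0.
  have {}Tx x y : triangle P Q S (x, y) -> P.1 <= x <= S.1.
    by apply: Tx; rewrite ?lexx ?PQ1 ?PS1 ?QS1.
  have PS : 0 < S.1 - P.1.
    rewrite subr_gt0 lt_neqAle PS1 andbT; apply/eqP => e.
    have eQ : Q.1 = P.1 by lra.
    by move: c0; rewrite /cross eQ -e !subrr; lra.
  (* [z] is the ordinate, above Q, of the point of PS with the abscissa of Q. *)
  pose z := (P.2 * (S.1 - Q.1) + S.2 * (Q.1 - P.1)) / (S.1 - P.1).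
  have zE : z * (S.1 - P.1) = P.2 * (S.1 - Q.1) + S.2 * (Q.1 - P.1).
    by rewrite divfK// gt_eqF.
  have cE : cross P Q S = (z - Q.2) * (S.1 - P.1).
    by rewrite mulrBl zE /cross; ring.
  have Qz : Q.2 <= z.
    by rewrite -subr_ge0 -(pmulr_lge0 _ PS) -cE ltW.
  rewrite (@measure_cut _ _ (Q.1, 0) (Q.1, 1))//.
  rewrite (@measure_between _ _ P.1 Q.1 P.2 Q.2 P.2 z)//; first last.
  + move=> x y /andP[Px xQ].
    have PQ : 0 < Q.1 - P.1 by lra.
    have upper : (S.1 - P.1) * (P.2 * (Q.1 - x) + z * (x - P.1) - (Q.1 - P.1) * y)
        = (Q.1 - P.1) * cross S P (x, y).
      by have := congr1 (fun t => t * (x - P.1)) zE; rewrite /cross /=; lra.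
    have iPQ : (Q.1 - P.1) * y - (P.2 * (Q.1 - x) + Q.2 * (x - P.1)) = cross P Q (x, y).
      by rewrite /cross /=; ring.
    rewrite -subr_ge0 iPQ -[X in _ && X]subr_ge0 -[X in _ && X](pmulr_rge0 _ PS)
      upper [X in _ && X]pmulr_rge0//.
    split=> [[[[PQX QSX] SPX] _]|/andP[PQX SPX]]; first exact/andP.
    split; last by apply/left_halfplane; exact: ltW.
    split=> //; split=> //; rewrite /halfplane /= -(pmulr_rge0 _ PQ).
    (* Over this strip the condition for QS follows from that for PQ. In each of the four strips,
       the third side's condition likewise follows from that of one of the two sides bounding the
       strip. *)
    have -> : (Q.1 - P.1) * cross Q S (x, y) =
        cross P Q S * (Q.1 - x) + cross P Q (x, y) * (S.1 - Q.1).
      by rewrite /cross /=; ring.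
    by apply: addr_ge0; apply: mulr_ge0; (done || exact: ltW || lra).
  + by move=> x y [/Tx/andP[-> _] /left_halfplane].
  + exact: measurableI.
  rewrite (@measure_between _ _ Q.1 S.1 Q.2 S.2 z S.2)//; first last.
  + move=> x y /andP[Qx xS].
    have QS : 0 < S.1 - Q.1 by lra.
    have upper : (S.1 - P.1) * (z * (S.1 - x) + S.2 * (x - Q.1) - (S.1 - Q.1) * y)
        = (S.1 - Q.1) * cross S P (x, y).
      by have := congr1 (fun t => t * (S.1 - x)) zE; rewrite /cross /=; lra.
    have iQS : (S.1 - Q.1) * y - (Q.2 * (S.1 - x) + S.2 * (x - Q.1)) = cross Q S (x, y).
      by rewrite /cross /=; ring.
    rewrite -subr_ge0 iQS -[X in _ && X]subr_ge0 -[X in _ && X](pmulr_rge0 _ PS)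
      upper [X in _ && X]pmulr_rge0//.
    split=> [[[[PQX QSX] SPX] _]|/andP[QSX SPX]]; first exact/andP.
    split; last by apply/right_halfplane; exact: ltW.
    split=> //; split=> //; rewrite /halfplane /= -(pmulr_rge0 _ QS).
    have -> : (S.1 - Q.1) * cross P Q (x, y) =
        cross P Q S * (x - Q.1) + cross Q S (x, y) * (Q.1 - P.1).
      by rewrite /cross /=; ring.
    by apply: addr_ge0; apply: mulr_ge0; (done || exact: ltW || lra).
  + by move=> x y [/Tx/andP[_ ->] /right_halfplane ->].
  + exact: measurableI.
  by rewrite -EFinD cE; congr EFin; field.
- have Tx x y := @triangle_between_abscissae P Q S P.1 Q.1 x y c0.
  have {}Tx x y : triangle P Q S (x, y) -> P.1 <= x <= Q.1.
    by apply: Tx; rewrite ?lexx ?PQ1 ?PS1 ?(ltW SQ1).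
  have PQ : 0 < Q.1 - P.1 by lra.
  (* [z] is the ordinate, below S, of the point of PQ with the abscissa of S. *)
  pose z := (P.2 * (Q.1 - S.1) + Q.2 * (S.1 - P.1)) / (Q.1 - P.1).
  have zE : z * (Q.1 - P.1) = P.2 * (Q.1 - S.1) + Q.2 * (S.1 - P.1).
    by rewrite divfK// gt_eqF.
  have cE : cross P Q S = (S.2 - z) * (Q.1 - P.1).
    by rewrite mulrBl zE /cross; ring.
  have zS : z <= S.2.
    by rewrite -subr_ge0 -(pmulr_lge0 _ PQ) -cE ltW.
  rewrite (@measure_cut _ _ (S.1, 0) (S.1, 1))//.
  rewrite (@measure_between _ _ P.1 S.1 P.2 z P.2 S.2)//; first last.
  + move=> x y /andP[Px xS].
    have PS : 0 < S.1 - P.1 by lra.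
    have lower : (Q.1 - P.1) * ((S.1 - P.1) * y - (P.2 * (S.1 - x) + z * (x - P.1)))
        = (S.1 - P.1) * cross P Q (x, y).
      by have := congr1 (fun t => t * (x - P.1)) zE; rewrite /cross /=; lra.
    have iSP : P.2 * (S.1 - x) + S.2 * (x - P.1) - (S.1 - P.1) * y = cross S P (x, y).
      by rewrite /cross /=; ring.
    rewrite -[X in _ && X]subr_ge0 iSP -[X in X && _]subr_ge0.
    rewrite -[X in X && _](pmulr_rge0 _ PQ) lower [X in X && _]pmulr_rge0//.
    split=> [[[[PQX QSX] SPX] _]|/andP[PQX SPX]]; first exact/andP.
    split; last by apply/left_halfplane; exact: ltW.
    split=> //; split=> //; rewrite /halfplane /= -(pmulr_rge0 _ PS).
    have -> : (S.1 - P.1) * cross Q S (x, y) =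
        cross P Q S * (S.1 - x) + cross S P (x, y) * (Q.1 - S.1).
      by rewrite /cross /=; ring.
    by apply: addr_ge0; apply: mulr_ge0; (done || exact: ltW || lra).
  + by move=> x y [/Tx/andP[-> _] /left_halfplane].
  + exact: measurableI.
  rewrite (@measure_between _ _ S.1 Q.1 z Q.2 S.2 Q.2)//; first last.
  + move=> x y /andP[Sx xQ].
    have SQ : 0 < Q.1 - S.1 by lra.
    have lower : (Q.1 - P.1) * ((Q.1 - S.1) * y - (z * (Q.1 - x) + Q.2 * (x - S.1)))
        = (Q.1 - S.1) * cross P Q (x, y).
      by have := congr1 (fun t => t * (Q.1 - x)) zE; rewrite /cross /=; lra.
    have iQS : S.2 * (Q.1 - x) + Q.2 * (x - S.1) - (Q.1 - S.1) * y = cross Q S (x, y).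
      by rewrite /cross /=; ring.
    rewrite -[X in _ && X]subr_ge0 iQS -[X in X && _]subr_ge0.
    rewrite -[X in X && _](pmulr_rge0 _ PQ) lower [X in X && _]pmulr_rge0//.
    split=> [[[[PQX QSX] SPX] _]|/andP[PQX QSX]]; first exact/andP.
    split; last by apply/right_halfplane; exact: ltW.
    split; first by split.
    rewrite /halfplane /= -(pmulr_rge0 _ SQ).
    have -> : (Q.1 - S.1) * cross S P (x, y) =
        cross P Q S * (x - S.1) + cross Q S (x, y) * (S.1 - P.1).
      by rewrite /cross /=; ring.
    by apply: addr_ge0; apply: mulr_ge0; (done || exact: ltW || lra).
  + by move=> x y [/Tx/andP[_ ->] /right_halfplane ->].
  + exact: ltW.
  + exact: measurableI.
  by rewrite -EFinD cE; congr EFin; field.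
Qed.

Lemma measure_triangle P Q S : 0 < cross P Q S ->
  mu2 (triangle P Q S) = (cross P Q S / 2)%:E.
Proof.
move=> c0; have QSP := cross_rot P Q S; have SPQ := cross_rot Q S P.
have : (P.1 <= Q.1 /\ P.1 <= S.1) \/ (Q.1 <= S.1 /\ Q.1 <= P.1) \/
    (S.1 <= P.1 /\ S.1 <= Q.1).
  have [PQ|QP] := leP P.1 Q.1; have [PS|SP] := leP P.1 S.1;
    have [QS|SQ] := leP Q.1 S.1; lra.
case=> [[PQ PS]|[[QS QP]|[SP SQ]]].
- exact: measure_triangle_leftmost.
- rewrite triangle_rot QSP; apply: measure_triangle_leftmost => //.
  by rewrite -QSP.
- rewrite -triangle_rot QSP SPQ; apply: measure_triangle_leftmost => //.
  by rewrite -SPQ -QSP.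
Qed.

End TriangleMeasure.

(** * The area of a convex hexagon by fan triangulation *)

Section HexagonArea.
Local Open Scope classical_set_scope.
Context {R : realType}.
Implicit Types A : 'I_6 -> R * R.

(** Numeric indices leave the side conditions to [lia]. From 6 on, [inord] falls back to 0, so
    successors are reduced with [%% 6]. *)
Definition vertex A (k : nat) : R * R := A (inord k).

Lemma vertexE A i : A i = vertex A i.
Proof. by rewrite /vertex inord_val. Qed.

Lemma vertex_ordS A (i : 'I_6) : A (ordS i) = vertex A (i.+1 %% 6)%N.
Proof. exact: vertexE. Qed.

Lemma convex_hexagonP A : convex_polygon A <->
  forall i j, (i < 6)%N -> (j < 6)%N -> (j != i)%N -> (j != i.+1 %% 6)%N ->
    0 < cross (vertex A i) (vertex A (i.+1 %% 6)%N) (vertex A j).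
Proof.
split=> [[_ H] i j i6 j6 ji jSi|H]; last first.
  by split=> // i j ji jSi; rewrite vertex_ordS (vertexE A i) (vertexE A j); apply: H.
have := H (Ordinal i6) (Ordinal j6) ji jSi.
by rewrite vertex_ordS !vertexE.
Qed.

(** A triple containing a cyclically adjacent pair is a side with a further vertex, which convexity
    covers up to rotation; the Plücker relation gives the rest. *)
Lemma convex_hexagon_cross A : convex_polygon A ->
  forall i j k, (i < j)%N -> (j < k)%N -> (k < 6)%N ->
    0 < cross (vertex A i) (vertex A j) (vertex A k).
Proof.
move=> /convex_hexagonP H.
have edge1 i k : (i.+1 < k < 6)%N ->
    0 < cross (vertex A i) (vertex A i.+1) (vertex A k).
  by move=> ik6; have := H i k; rewrite modn_small; [apply; lia|lia].
have edge2 i j : (i < j < 5)%N -> 0 < cross (vertex A i) (vertex A j) (vertex A j.+1).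
  by move=> ij5; rewrite cross_rot; have := H j i; rewrite modn_small; [apply; lia|lia].
have edge3 j : (0 < j < 5)%N -> 0 < cross (vertex A 0) (vertex A j) (vertex A 5).
  by move=> j5; rewrite -cross_rot; apply: (H 5%N j); lia.
have skip i : (i < 2)%N -> 0 < cross (vertex A i) (vertex A i.+2) (vertex A i.+4).
  move=> i2; have i13 : 0 < cross (vertex A i) (vertex A i.+1) (vertex A i.+3).
    by apply: edge1; lia.
  (* The only triples without a cyclically consecutive pair are (0,2,4) and (1,3,5). *)
  rewrite -(pmulr_rgt0 _ i13) cross_plucker.
  by apply: addr_gt0; apply: mulr_gt0; ((apply: edge1; lia) || (apply: edge2; lia)).
move=> i j k ij jk k6.
have [jE|jN] := eqVneq j i.+1; first by rewrite jE; apply: edge1; lia.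
have [kE|kN] := eqVneq k j.+1; first by rewrite kE; apply: edge2; lia.
have [k5|k5] := eqVneq k 5%N.
  have [i0|i0] := eqVneq i 0%N; first by rewrite k5 i0; apply: edge3; lia.
  have [-> ->] : i = 1%N /\ j = 3%N by lia.
  by rewrite k5; exact: skip.
have [-> -> ->] : [/\ i = 0%N, j = 2%N & k = 4%N] by split; lia.
exact: skip.
Qed.

(** Twice the signed area, as a fan of triangles from vertex 0. *)
Definition shoelace A : R :=
  let c i := cross (vertex A 0) (vertex A i) (vertex A i.+1) in
  c 1%N + c 2%N + c 3%N + c 4%N.

Lemma area_hexagon A : convex_polygon A -> area A = shoelace A / 2.
Proof.
move=> cA; have T := convex_hexagon_cross A cA.
move/convex_hexagonP in cA.
set D := polygon_region A; set v := vertex A in T cA *.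
have D_edge i : (i < 6)%N -> D `<=` halfplane (v i) (v (i.+1 %% 6)%N).
  move=> i6; apply: polygon_region_sub_halfplane => j; rewrite vertexE -/v.
  have [->|ji] := eqVneq (j : nat) i; first by rewrite /cross; lra.
  have [->|jSi] := eqVneq (j : nat) (i.+1 %% 6)%N; first by rewrite /cross; lra.
  by apply/ltW/cA.
have D_tri i : (0 < i < 5)%N -> triangle (v 0) (v i) (v i.+1) `<=` D.
  move=> i5; rewrite /v /vertex; apply: triangle_sub_polygon_region.
  by apply: T; lia.
have T_hp i j : (0 < i < j)%N -> (j < 5)%N ->
    triangle (v 0) (v j) (v j.+1) `<=` halfplane (v 0) (v i).
  move=> ij j5; apply: triangle_sub_halfplane; first by apply: T; lia.
  - by rewrite /cross; lra.
  - by apply/ltW/T; lia.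
  - by apply/ltW/T; lia.
(* What is left of the hexagon after cutting along the diagonals from [v 0] to [v 2], [v 3], [v 4]
   in turn. Each piece cut off is a fan triangle: the outer sides bound it, and conversely the hull
   contains every triangle of vertices. *)
pose D2 := D `&` halfplane (v 0) (v 2).
pose D3 := D2 `&` halfplane (v 0) (v 3).
pose D4 := D3 `&` halfplane (v 0) (v 4).
have E1 : D `&` halfplane (v 2) (v 0) = triangle (v 0) (v 1) (v 2).
  apply/seteqP; split=> X.
    by move=> [DX h]; split=> //; split; [exact: (D_edge 0)|exact: (D_edge 1)].
  by move=> TX; split; [exact: (D_tri 1)|case: TX].
have E2 : D2 `&` halfplane (v 3) (v 0) = triangle (v 0) (v 2) (v 3).
  apply/seteqP; split=> X.
    by move=> [[DX ?] ?]; split=> //; split=> //; exact: (D_edge 2).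
  by move=> TX; split; [split; [exact: (D_tri 2)|case: TX => [[]]]|case: TX].
have E3 : D3 `&` halfplane (v 4) (v 0) = triangle (v 0) (v 3) (v 4).
  apply/seteqP; split=> X.
    by move=> [[[DX ?] ?] ?]; split=> //; split=> //; exact: (D_edge 3).
  move=> TX; split; last by case: TX.
  split; last by case: TX => [[]].
  by split; [exact: (D_tri 3)|exact: (T_hp 2 3)].
have E4 : D4 = triangle (v 0) (v 4) (v 5).
  apply/seteqP; split=> X.
    move=> [[[DX ?] ?] ?]; split; [split=> //|]; first exact: (D_edge 4).
    exact: (D_edge 5).
  move=> TX; split; last by case: TX => [[]].
  split; last exact: (T_hp 3 4).
  by split; [exact: (D_tri 4)|exact: (T_hp 2 4)].
(* Measurability of the hull is obtained backwards: from the last fan triangle, each remainder is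
   the union of the next one and a triangle. *)
have cut (B : set (R * R)) P Q : B = (B `&` halfplane P Q) `|` (B `&` halfplane Q P).
  apply/seteqP; split=> X; last by case=> -[].
  move=> BX; have [?|/ltW c0] := leP 0 (cross P Q X); first by left.
  by right; split=> //; rewrite /halfplane /= cross_swap oppr_ge0.
have mt P Q S := @measurable_triangle R P Q S.
have m3 : measurable D3 by rewrite (cut D3 (v 0) (v 4)) -/D4 E3 E4; exact: measurableU.
have m2 : measurable D2 by rewrite (cut D2 (v 0) (v 3)) -/D3 E2; exact: measurableU.
have mD : measurable D by rewrite (cut D (v 0) (v 2)) -/D2 E1; exact: measurableU.
have v0 i : (1 < i < 6)%N -> v 0 != v i.
  move=> i6; apply/eqP => v0i.
  have : 0 < cross (v 0) (v 1) (v i) by apply: T; lia.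
  by rewrite -v0i /cross; lra.
rewrite /area -/D (measure_cut _ _ _ _ (v0 2%N isT))// E1 -/D2.
rewrite (measure_cut _ _ _ _ (v0 3%N isT))// E2 -/D3.
rewrite (measure_cut _ _ _ _ (v0 4%N isT))// E3 -/D4 E4.
rewrite !measure_triangle ?T// -!EFinD/= /shoelace -/v; lra.
Qed.

End HexagonArea.

(** * Convexity and area of the descendant *)

Section Kasner.
Context {R : realType}.
Implicit Types (A : 'I_6 -> R * R) (P Q S X Y : R * R) (m : R).

(** Multi-affine expansion: [c Z] is the cross of the two consecutive descendant vertices with Z.
    For m in (0,1) all its coefficients are positive, so signs pass from the hexagon to its
    descendant. *)
Lemma cross_kasner m P Q S X Y :
  cross (P + m *: (Q - P)) (Q + m *: (S - Q)) (X + m *: (Y - X)) =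
    let c Z := (1 - m) ^+ 2 * cross P Q Z + (1 - m) * m * cross P S Z +
      m ^+ 2 * cross Q S Z in (1 - m) * c X + m * c Y.
Proof. by rewrite /cross /= /GRing.scale /=; ring. Qed.

Lemma vertex_kasner m A i : (i < 6)%N ->
  vertex (kasner m A) i =
    vertex A i + m *: (vertex A (i.+1 %% 6)%N - vertex A i).
Proof. by move=> i6; rewrite {1}/vertex /kasner vertex_ordS inordK. Qed.

Lemma convex_hexagon_cyclic A : convex_polygon A ->
  forall i j k, (i < 6)%N -> (j < 6)%N -> (k < 6)%N ->
    [|| (i < j < k), (j < k < i) | (k < i < j)]%N ->
    0 < cross (vertex A i) (vertex A j) (vertex A k).
Proof.
move=> cA i j k i6 j6 k6 /or3P[]/andP[? ?].
- exact: convex_hexagon_cross.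
- by rewrite cross_rot; apply: convex_hexagon_cross.
- by rewrite -cross_rot; apply: convex_hexagon_cross.
Qed.

Lemma convex_kasner_hexagon m A : 0 < m < 1 ->
  convex_polygon A -> convex_polygon (kasner m A).
Proof.
move=> /andP[m0 m1] cA; have T := convex_hexagon_cyclic A cA.
apply/convex_hexagonP => i j i6 j6 ji jSi; rewrite !vertex_kasner ?ltn_mod//.
rewrite cross_kasner /=.
set v := vertex A in T *; set Q := (i.+1 %% 6)%N in jSi *; set S := (Q.+1 %% 6)%N.
have n0 : 0 < 1 - m by lra.
have degenerate (P U : R * R) : cross P U P = 0 /\ cross P U U = 0.
  by rewrite /cross; split; ring.
(* The corner [v Q] is the only vertex on the wrong side of this descendant side. Since j is neither
   i nor Q, neither j nor its successor is Q. *)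
suff c k : (k < 6)%N -> k != Q ->
    0 < (1 - m) ^+ 2 * cross (v i) (v Q) (v k) +
      (1 - m) * m * cross (v i) (v S) (v k) + m ^+ 2 * cross (v Q) (v S) (v k).
  by apply: addr_gt0; apply: mulr_gt0 => //; apply: c; lia.
move=> k6 kQ.
have w1 : 0 < (1 - m) ^+ 2 by exact: exprn_gt0.
have w2 : 0 < (1 - m) * m by exact: mulr_gt0.
have w3 : 0 < m ^+ 2 by exact: exprn_gt0.
(* For k = i and for k = S two of the three terms vanish, and the surviving one is a positive
   multiple of the ear at Q. *)
have [ki|ki] := eqVneq k i.
  rewrite ki !(degenerate _ _).1 !mulr0 !add0r mulr_gt0//.
  by apply: T; lia.
have [kS|kS] := eqVneq k S.
  rewrite kS !(degenerate _ _).2 !mulr0 !addr0 mulr_gt0//.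
  by apply: T; lia.
by apply: addr_gt0; [apply: addr_gt0|]; apply: mulr_gt0 => //; apply: T; lia.
Qed.

Let mod6 : (0 %% 6 = 0)%N * (1 %% 6 = 1)%N * (2 %% 6 = 2)%N * (3 %% 6 = 3)%N *
  (4 %% 6 = 4)%N * (5 %% 6 = 5)%N * (6 %% 6 = 0)%N * (7 %% 6 = 1)%N.
Proof. by []. Qed.

Definition ear A (i : nat) : R :=
  cross (vertex A (i %% 6)%N) (vertex A (i.+1 %% 6)%N) (vertex A (i.+2 %% 6)%N).

Lemma shoelace_kasner m A : shoelace (kasner m A) =
  shoelace A - m * (1 - m) * \sum_(0 <= i < 6) ear A i.
Proof.
rewrite unlock /= /ear /shoelace /= !vertex_kasner// !mod6.
rewrite /cross /= /GRing.scale /=; ring.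
Qed.

(** Removing the even ears leaves the triangle 0 2 4, removing the odd ones the triangle 1 3 5; the
    two dissections are added. *)
Lemma sum_ear A : \sum_(0 <= i < 6) ear A i = 2 * shoelace A -
  (cross (vertex A 0) (vertex A 2) (vertex A 4) +
   cross (vertex A 1) (vertex A 3) (vertex A 5)).
Proof.
by rewrite unlock /= /ear /shoelace /= !mod6 /cross; ring.
Qed.

Lemma convex_hexagon_sum_ear_gt0 A : convex_polygon A ->
  0 < \sum_(0 <= i < 6) ear A i.
Proof.
move=> cA; rewrite big_nat_recl//; apply: ltr_pwDl.
  by apply: convex_hexagon_cyclic.
rewrite big_nat_cond; apply: sumr_ge0 => i; rewrite andbT => i5.
by apply/ltW/convex_hexagon_cyclic => //; rewrite ?ltn_mod//; lia.
Qed.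

Lemma convex_hexagon_shoelace_gt0 A : convex_polygon A -> 0 < shoelace A.
Proof.
move=> /convex_hexagon_cross T; rewrite /shoelace /=.
have T0 i : (0 < i < 5)%N -> 0 < cross (vertex A 0) (vertex A i) (vertex A i.+1).
  by move=> i5; apply: T; lia.
by move: (T0 1%N isT) (T0 2%N isT) (T0 3%N isT) (T0 4%N isT); lra.
Qed.

Lemma area_ratio_kasner m A : 0 < m < 1 -> convex_polygon A ->
  area (kasner m A) / area A =
    1 - m * (1 - m) * ((\sum_(0 <= i < 6) ear A i) / shoelace A).
Proof.
move=> m01 cA; rewrite !area_hexagon//; last exact: convex_kasner_hexagon.
have S0 : shoelace A != 0 by rewrite gt_eqF// convex_hexagon_shoelace_gt0.
by rewrite shoelace_kasner; move: (\sum_(_ <= _ < _) _) => E; field.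
Qed.

End Kasner.

(** * Hexagons approaching the two bounds *)

Section Extremal.
Context {R : realType}.

Definition hexagon (s : seq (R * R)) : 'I_6 -> R * R := fun i => nth (0, 0) s i.

Lemma vertex_hexagon s k : (k < 6)%N -> vertex (hexagon s) k = nth (0, 0) s k.
Proof. by move=> k6; rewrite /vertex /hexagon inordK. Qed.

(** The triangle (0,0), (1,0), (0,1) with its corners cut off; the vertices merge in pairs as d
    tends to 0, and the area ratio tends to 1. *)
Definition cut_triangle (d : R) := hexagon
  [:: (0, d); (d, 0); (1 - d, 0); (1 - d, d); (d, 1 - d); (0, 1 - d)].

(** The same triangle with the corner at the origin replaced by a convex chain of four vertices,
    which merge as d tends to 0; this approaches the lower bound. *)
Definition blunt_triangle (d : R) := hexagon
  [:: (d, 2 * d); (2 * d, d); (4 * d, 0); (1, 0); (0, 1); (0, 4 * d)].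

Lemma cut_triangle_convex d : 0 < d -> d <= 8^-1 -> convex_polygon (cut_triangle d).
Proof.
move=> d0 d1; have d2 : 0 < d * d by exact: mulr_gt0.
apply/convex_hexagonP => i j i6 j6 ji jSi.
rewrite !vertex_hexagon ?ltn_mod//.
move: i j i6 j6 ji jSi.
by case=> [|[|[|[|[|[|//]]]]]] [|[|[|[|[|[|//]]]]]] // _ _ _ _; rewrite /cross /=; nra.
Qed.

Lemma blunt_triangle_convex d : 0 < d -> d <= 20^-1 -> convex_polygon (blunt_triangle d).
Proof.
move=> d0 d1; have d2 : 0 < d * d by exact: mulr_gt0.
apply/convex_hexagonP => i j i6 j6 ji jSi.
rewrite !vertex_hexagon ?ltn_mod//.
move: i j i6 j6 ji jSi.
by case=> [|[|[|[|[|[|//]]]]]] [|[|[|[|[|[|//]]]]]] // _ _ _ _; rewrite /cross /=; nra.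
Qed.

(** Each of the six ears equals d (1 - 2 d), and the doubled area is 1 - 3 d^2. *)
Lemma sum_ear_cut_triangle d : 0 < d -> d <= 8^-1 ->
  \sum_(0 <= i < 6) ear (cut_triangle d) i <= 12 * d * shoelace (cut_triangle d).
Proof.
move=> d0 d1; rewrite sum_ear /shoelace /= !vertex_hexagon// /cross /=.
have d2 : 0 < d * d by exact: mulr_gt0.
nra.
Qed.

(** The ears at (1,0) and (0,1) are 1 - 4 d each; the full sum is 2 - 6 d - 6 d^2, against a doubled
    area of 1 - 11 d^2. *)
Lemma sum_ear_blunt_triangle d : 0 < d -> d <= 20^-1 ->
  (2 - 12 * d) * shoelace (blunt_triangle d) <=
    \sum_(0 <= i < 6) ear (blunt_triangle d) i.
Proof.
move=> d0 d1; rewrite sum_ear /shoelace /= !vertex_hexagon// /cross /=.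
have d2 : 0 < d * d by exact: mulr_gt0.
nra.
Qed.

End Extremal.

(** * The bounds and their sharpness *)

Theorem theorem6p1 (R : realType) (m : R) (m_gt0 : 0 < m) (m_lt1 : m < 1) :
  (forall K : 'I_6 -> R * R, convex_polygon K ->
     1 - 2 * m * (1 - m) < area (kasner m K) / area K /\
     area (kasner m K) / area K < 1) /\
  (forall eps : R, 0 < eps ->
     (exists K : 'I_6 -> R * R, convex_polygon K /\
        area (kasner m K) / area K < 1 - 2 * m * (1 - m) + eps) /\
     (exists K : 'I_6 -> R * R, convex_polygon K /\
        1 - eps < area (kasner m K) / area K)).
Proof.
have m01 : 0 < m < 1 by rewrite m_gt0 m_lt1.
have q0 : 0 < m * (1 - m) by nra.
have q1 : m * (1 - m) < 1 by nra.
split=> [K cK|eps eps0].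
  rewrite area_ratio_kasner//.
  have S0 := convex_hexagon_shoelace_gt0 K cK.
  have r0 : 0 < (\sum_(0 <= i < 6) ear K i) / shoelace K.
    by rewrite divr_gt0// convex_hexagon_sum_ear_gt0.
  have r2 : (\sum_(0 <= i < 6) ear K i) / shoelace K < 2.
    rewrite ltr_pdivrMr// sum_ear.
    have := convex_hexagon_cross K cK 0 2 4 isT isT isT.
    have := convex_hexagon_cross K cK 1 3 5 isT isT isT.
    lra.
  by split; nra.
(* In both examples the ear ratio is within 12 d of its limit on the side that matters, and it is
   multiplied by m (1 - m) < 1. *)
have [d [d0 d1 dE]] : exists d : R, [/\ 0 < d, d <= 20^-1 & 12 * d < eps].
  have [e1|e1] := leP eps 1.
    by exists (eps / 20); split; lra.
  by exists (20^-1); split; lra.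
split.
  have cK := blunt_triangle_convex _ d0 d1.
  exists (blunt_triangle d); split=> //; rewrite area_ratio_kasner//.
  have := sum_ear_blunt_triangle _ d0 d1.
  rewrite -ler_pdivlMr ?convex_hexagon_shoelace_gt0//.
  by move: (_ / _) => r r_ge; nra.
have d8 : d <= 8^-1 by lra.
have cK := cut_triangle_convex _ d0 d8.
exists (cut_triangle d); split=> //; rewrite area_ratio_kasner//.
have := sum_ear_cut_triangle _ d0 d8.
rewrite -ler_pdivrMr ?convex_hexagon_shoelace_gt0//.
by move: (_ / _) => r r_le; nra.
Qed.
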